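(* Let $n=4k$ with $k\ge2$, and let $\tau$ be an integer with $1\le\tau\le k$. Let $u_1,\ldots,u_k\in\mathbb{F}_{2^{2k}}^*$ be such that $u_iu_j^{2^k}\in\mathbb{F}_{2^k}^*$ for all $1\le i<j\le k$. Let $F(X_1,\ldots,X_\tau)$ be a reduced polynomial in $\mathbb{F}_2[X_1,\ldots,X_\tau]$ of algebraic degree $d$, let $\omega$ be a generator of the cyclic group $U=\{x\in\mathbb{F}_{2^{2k}}: x^{2^k+1}=1\}$, and let $\{i_1,\ldots,i_\tau\}\subseteq\{1,\ldots,k\}$. Then $H(x)=\mathrm{Tr}^n_k(\omega x^{2^k+1})+F(\mathrm{Tr}^n_1(u_{i_1}x),\ldots,\mathrm{Tr}^n_1(u_{i_\tau}x))$ is a vectorial bent $(n,k)$-function. Furthermore, if $u_1,\ldots,u_k$ are linearly independent over $\mathbb{F}_2$ and $d\ge2$, then $H$ has algebraic degree $d$.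
   Context: $\mathrm{Tr}^m_1(x)=\sum_{i=0}^{m-1}x^{2^i}$, $\mathrm{Tr}^{4k}_k(x)=x+x^{2^k}+x^{2^{2k}}+x^{2^{3k}}$. An $(n,k)$-function $H$ is vectorial bent if $\mathrm{Tr}^k_1(\lambda H(x))$ is bent for every $\lambda\in\mathbb{F}_{2^k}^*$ (bent: $|\sum_x(-1)^{f(x)+\mathrm{Tr}^n_1(ax)}|=2^{n/2}$ for all $a$). A reduced polynomial is a multilinear polynomial over $\mathbb{F}_2$; its algebraic degree is the largest size of a monomial with nonzero coefficient. The algebraic degree of a vectorial function is the maximal algebraic degree of its coordinate Boolean functions. *)

(* Defs.v *)
From HB Require Import structures.
From mathcomp Require Import all_boot all_order all_algebra all_field.
Set Implicit Arguments. Unset Strict Implicit. Unset Printing Implicit Defensive.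
Import Order.TTheory GRing.Theory Num.Theory.
Local Open Scope ring_scope.

Section Defs.
Variable F : finFieldType.

Definition in_subfield (m : nat) (x : F) : bool := x ^+ (2 ^ m) == x.

Definition trace1 (m : nat) (x : F) : F := \sum_(i < m) x ^+ (2 ^ i).

Definition trace_4k_k (k : nat) (x : F) : F :=
  x + x ^+ (2 ^ k) + x ^+ (2 ^ (2 * k)) + x ^+ (2 ^ (3 * k)).

Definition to_bool (x : F) : bool := x == 1.

Definition walsh (n : nat) (f : F -> bool) (a : F) : int :=
  \sum_(x : F) (-1) ^+ (f x (+) to_bool (trace1 n (a * x))).

Definition bent (n : nat) (f : F -> bool) : Prop :=
  forall a : F, `|walsh n f a| = (2 ^ (n %/ 2))%N :> int.

Definition vbent (n k : nat) (H : F -> F) : Prop :=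
  forall lam : F, in_subfield k lam -> lam != 0 ->
    bent n (fun x => to_bool (trace1 k (lam * H x))).

Definition lincomb (m : nat) (e : 'I_m -> F) (b : 'I_m -> bool) : F :=
  \sum_(i < m) (nat_of_bool (b i))%:R * e i.

Definition basis_of_subfield (s m : nat) (e : 'I_m -> F) : Prop :=
  injective (fun b : {ffun 'I_m -> bool} => lincomb e b) /\
  (forall b : {ffun 'I_m -> bool}, in_subfield s (lincomb e b)) /\
  (forall x, in_subfield s x -> exists b : {ffun 'I_m -> bool}, lincomb e b = x).

Definition F2_lin_indep (m : nat) (e : 'I_m -> F) : Prop :=
  forall b : 'I_m -> bool, lincomb e b = 0 -> forall i, b i = false.

End Defs.

(* A reduced (multilinear) polynomial in F_2[X_0..X_{m-1}], given by its set
   of monomials (each monomial = set of variables occurring in it). *)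
Definition anf_eval (m : nat) (P : {set {set 'I_m}}) (b : 'I_m -> bool) : bool :=
  \big[addb/false]_(S in P) [forall i in S, b i].

Definition anf_deg (m : nat) (P : {set {set 'I_m}}) : nat :=
  \max_(S in P) #|S|.

(* Algebraic degree of a vectorial function H : F_{2^n} -> F_{2^s}:
   its coordinate functions w.r.t. an F_2-basis c of F_{2^s}, written in
   the coordinates of an F_2-basis e of F_{2^n}, have the reduced polynomial
   representations P j, and d is the maximal degree. (Coordinates and ANFs
   are unique for given bases, and the degree is basis independent.) *)
Definition vec_alg_degree (F : finFieldType) (n s : nat) (H : F -> F) (d : nat)
  : Prop :=
  exists (e : 'I_n -> F) (c : 'I_s -> F) (P : 'I_s -> {set {set 'I_n}}),
    [/\ basis_of_subfield n e, basis_of_subfield s c,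
        (forall b : {ffun 'I_n -> bool},
            H (lincomb e b) = lincomb c (fun j => anf_eval (P j) b)) &
        d = \max_(j < s) anf_deg (P j)].

(* Main.v *)
(** Put q = 2^k and let L be the subfield F_{q^2}, whose trace-orthogonal is L itself.
Since u_i is in L and Tr^n_1 vanishes on L, the summand F(Tr(u_{i_1} x), ...) is invariant
under translation by L; also Tr^n_1(lam omega z^{q+1}) = 0 for z in L and lam in F_q.  Hence
the component f = Tr^k_1(lam H) satisfies f(x + z) = f(x) + Tr^n_1(z T(x)) for z in L, with
T(x) = lam (omega x^q + omega^q x^{q^3}); T is bijective and T(x) is in L iff x is, because
omega + omega^q <> 0.  Averaging the Walsh sum at a over translations by L leaves only the x
with T(x) + a in L, a single coset of L on which all terms agree, so its absolute value is
|L| = 2^{n/2}.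

For the degree, extend the u_{i_j} to a basis of F_{2^n} and use trace-dual coordinates, in
which F(Tr(u_{i_1} x), ...) is F itself.  The other summand is quadratic, so only d = 2 could
fail, by cancellation; but H(x+1) + H(x) + H(1) + H(0) = Tr^n_k((omega + omega^q) x) is not
identically zero, so H is not affine. *)
Require Import Defs.
From HB Require Import structures.
From mathcomp Require Import all_boot all_order all_algebra all_field.
From mathcomp Require Import zify ring.
Import Order.TTheory GRing.Theory Num.Theory.
Local Open Scope ring_scope.

(** * Subfields of a finite field of characteristic 2 and the absolute trace *)

Section Subfields.
Set Implicit Arguments. Unset Strict Implicit. Unset Printing Implicit Defensive.
Variable F : finFieldType.

(** Induction on [r]: since $a-b$ divides $a^q-b^q$, divisibility of $X^{q^{r+1}}-X$ passes to
    $X^{q^{r+2}}-X^q$, and adding $X^q-X$ gives the next case. *)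
Lemma dvdp_Xq_sub_X (q r : nat) : (0 < r)%N ->
  ('X^q - 'X : {poly F}) %| 'X^(q ^ r) - 'X.
Proof.
elim: r => [|[|r] IH] // _.
rewrite (_ : 'X^(q ^ r.+2) - 'X = ('X^(q ^ r.+1) ^+ q - 'X ^+ q) + ('X^q - 'X)).
  by rewrite dvdp_addl ?dvdpp // subrXX dvdp_mulr // IH.
by rewrite -exprM -expnSr addrA subrK.
Qed.

(** $X^{2^m}-X$ divides $X^{|F|}-X=\prod_{x\in F}(X-x)$, so it is a product of distinct linear
    factors and has as many roots in [F] as its degree. *)
Lemma card_in_subfield (m r : nat) : (0 < m)%N -> (0 < r)%N ->
  #|F| = (2 ^ (m * r))%N -> #|[set x : F | in_subfield m x]| = (2 ^ m)%N.
Proof.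
move=> m_gt0 r_gt0 cardF.
have q_gt1 : (1 < 2 ^ m)%N by rewrite -{1}(expn0 2) ltn_exp2l.
have szp : size ('X^(2 ^ m) - 'X : {poly F}) = (2 ^ m).+1.
  by rewrite size_polyDl size_polyXn // size_polyN size_polyX.
have := dvdp_Xq_sub_X (2 ^ m) r_gt0.
rewrite -expnM -cardF finField_genPoly -big_enum /=.
case/(@dvdp_prod_XsubC _ _ _ (fun x => x)) => msk eqp_msk.
set s := mask msk _ in eqp_msk.
have /eqP := eqp_size eqp_msk; rewrite szp size_prod_XsubC eqSS => /eqP ->.
have uniq_s : uniq s by rewrite mask_uniq // enum_uniq.
rewrite -(card_uniqP uniq_s); apply: eq_card => x.
rewrite inE -root_prod_XsubC -(eqp_root eqp_msk) rootE !hornerE.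
by rewrite /in_subfield subr_eq0.
Qed.

Hypothesis char2 : 2%N \in [pchar F].

Lemma expr2D (i : nat) (x y : F) : (x + y) ^+ (2 ^ i) = x ^+ (2 ^ i) + y ^+ (2 ^ i).
Proof. by rewrite exprDn_pchar // pnatX pnatE // char2. Qed.

Lemma expr2_sum (I : Type) (s : seq I) (Q : pred I) (f : I -> F) (i : nat) :
  (\sum_(j <- s | Q j) f j) ^+ (2 ^ i) = \sum_(j <- s | Q j) f j ^+ (2 ^ i).
Proof.
by apply: (big_morph (fun x => x ^+ (2 ^ i)) (expr2D i)); rewrite expr0n expn_eq0.
Qed.

Lemma addr2_eq0 (x y : F) : (x + y == 0) = (x == y).
Proof. by rewrite addr_eq0 (oppr_pchar2 char2). Qed.

Lemma in_subfieldD m (x y : F) :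
  in_subfield m x -> in_subfield m y -> in_subfield m (x + y).
Proof. by rewrite /in_subfield expr2D => /eqP-> /eqP->. Qed.

Lemma in_subfieldM m (x y : F) :
  in_subfield m x -> in_subfield m y -> in_subfield m (x * y).
Proof. by rewrite /in_subfield exprMn => /eqP-> /eqP->. Qed.

Lemma in_subfieldV m (x : F) : in_subfield m x -> in_subfield m x^-1.
Proof. by rewrite /in_subfield exprVn => /eqP->. Qed.

Lemma in_subfield0 m : in_subfield m (0 : F).
Proof. by rewrite /in_subfield expr0n expn_eq0. Qed.

Lemma in_subfield1 m : in_subfield m (1 : F).
Proof. by rewrite /in_subfield expr1n. Qed.

Lemma in_subfieldX m (x : F) j : in_subfield m x -> in_subfield m (x ^+ j).
Proof. by rewrite /in_subfield exprAC => /eqP->. Qed.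

Lemma in_subfield_addrK m (x y : F) :
  in_subfield m y -> in_subfield m (x + y) = in_subfield m x.
Proof.
move=> hy; apply/idP/idP => [h|h]; last exact: in_subfieldD.
by rewrite -(addrK_pchar2 char2 y x) in_subfieldD.
Qed.

Lemma trace1D m (x y : F) : trace1 m (x + y) = trace1 m x + trace1 m y.
Proof. by rewrite /trace1 -big_split; apply: eq_bigr => i _; rewrite expr2D. Qed.

Lemma trace1_0 m : trace1 m (0 : F) = 0.
Proof. by rewrite /trace1 big1 // => i _; rewrite expr0n expn_eq0. Qed.

Lemma trace1_split a b (x : F) :
  trace1 (a + b) x = trace1 a x + trace1 b (x ^+ (2 ^ a)).
Proof.
rewrite /trace1 big_split_ord; congr (_ + _); apply: eq_bigr => i _ /=.
by rewrite -exprM expnD.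
Qed.

Lemma trace1_double m (x : F) : trace1 (2 * m) x = trace1 m (x + x ^+ (2 ^ m)).
Proof. by rewrite mul2n -addnn trace1_split trace1D. Qed.

Lemma trace1_4k k (x : F) : trace1 (4 * k) x = trace1 k (trace_4k_k k x).
Proof.
rewrite (_ : 4 * k = k + k + k + k)%N; last by lia.
by rewrite /trace_4k_k !trace1_split !trace1D !mulSn mul0n !addn0 !addnA.
Qed.

(** Squaring moves each summand to the next one, and $x^{2^m}=x$ closes the cycle. *)
Lemma trace1_sqr m (x : F) : in_subfield m x -> trace1 m x ^+ 2 = trace1 m x.
Proof.
rewrite -(expn1 2) {2}/trace1 expr2_sum => /eqP xm.
case: m xm => [|m] xm; first by rewrite /trace1 !big_ord0.
rewrite /trace1 big_ord_recr big_ord_recl /= expn1 -exprM -expnSr xm expn0 expr1.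
by rewrite addrC; congr (_ + _); apply: eq_bigr => i _; rewrite -exprM -expnSr.
Qed.

(** The trace $t$ satisfies $t^2=t$, so $t$ is 0 or 1. This lets field-valued traces be exchanged
    for booleans. *)
Lemma trace1_01 m (x : F) : in_subfield m x -> trace1 m x = (to_bool (trace1 m x))%:R.
Proof.
move/trace1_sqr/eqP; rewrite -subr_eq0 expr2 -{3}[trace1 m x]mulr1 -mulrBr mulf_eq0.
rewrite subr_eq0 /to_bool => /orP[]/eqP->; last by rewrite eqxx.
by rewrite eq_sym oner_eq0.
Qed.

(** The trace is a polynomial of degree $2^{m-1}$, too small to vanish on all $2^m$ elements of the
    subfield; a nonzero value must be 1. *)
Lemma trace1_neq0 m r : (0 < m)%N -> (0 < r)%N -> #|F| = (2 ^ (m * r))%N ->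
  exists2 w : F, in_subfield m w & trace1 m w = 1.
Proof.
move=> m_gt0 r_gt0 cardF.
pose p : {poly F} := \sum_(i < m) 'X^(2 ^ i).
have szp : size p = (2 ^ m.-1).+1.
  case: m m_gt0 @p {cardF} => // m _ /=.
  rewrite big_ord_recr /= addrC size_polyDl size_polyXn // ltnS.
  apply: leq_trans (size_sum _ _ _) _; apply/bigmax_leqP => i _.
  by rewrite size_polyXn ltn_exp2l.
have [w /andP[wm w1]|none] := pickP (fun w : F => in_subfield m w && (trace1 m w != 0)).
  by exists w => //; move: w1; rewrite trace1_01 //; case: (to_bool _); rewrite ?eqxx.
have p_neq0 : p != 0 by rewrite -size_poly_eq0 szp.
have /allP roots_p : {in enum [set x : F | in_subfield m x], forall x, root p x}.
  move=> x; rewrite mem_enum inE => xm; rewrite rootE horner_sum.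
  have := none x; rewrite xm /= => /negbFE/eqP t0; apply/eqP; rewrite -[RHS]t0.
  by apply: eq_bigr => i _; rewrite hornerXn.
have := max_poly_roots p_neq0 roots_p (enum_uniq _).
rewrite -cardE (card_in_subfield m_gt0 r_gt0) // szp ltnS leq_exp2l //.
by rewrite leqNgt prednK // leqnn.
Qed.

Lemma natr_addb (b c : bool) : (b (+) c)%:R = b%:R + c%:R :> F.
Proof. by case: b c => [] []; rewrite ?addr0 ?add0r // (addrr_pchar2 char2). Qed.

Lemma to_bool_natr (b : bool) : to_bool (b%:R : F) = b.
Proof. by case: b; rewrite /to_bool ?eqxx // eq_sym oner_eq0. Qed.

Lemma to_bool_trace1D m (x y : F) : in_subfield m x -> in_subfield m y ->
  to_bool (trace1 m (x + y)) = to_bool (trace1 m x) (+) to_bool (trace1 m y).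
Proof.
by move=> xm ym; rewrite trace1D trace1_01 // (trace1_01 ym) -natr_addb !to_bool_natr.
Qed.

(** The trace to the half subfield is $x+x^{2^m}=x+x=0$. *)
Lemma trace1_half m (x : F) : in_subfield m x -> trace1 (2 * m) x = 0.
Proof. by rewrite trace1_double => /eqP->; rewrite (addrr_pchar2 char2) trace1_0. Qed.

End Subfields.

(** * A bentness criterion based on translations by the half subfield $L=\mathbb{F}_{2^m}$ *)

Section Bent.
Set Implicit Arguments. Unset Strict Implicit. Unset Printing Implicit Defensive.
Variables (F : finFieldType) (m : nat).
Hypotheses (char2 : 2%N \in [pchar F]) (m_gt0 : (0 < m)%N).
Hypothesis cardF : #|F| = (2 ^ (2 * m))%N.

Let psi (x : F) := to_bool (trace1 (2 * m) x).

Lemma in_subfieldT (x : F) : in_subfield (2 * m) x.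
Proof. by rewrite /in_subfield -cardF expf_card. Qed.

Let psiD x y : psi (x + y) = psi x (+) psi y.
Proof. by rewrite /psi to_bool_trace1D // in_subfieldT. Qed.

Let psi_half x : in_subfield m x -> psi x = false.
Proof. by move=> xm; rewrite /psi trace1_half // /to_bool eq_sym oner_eq0. Qed.

Let card_half : #|[set x : F | in_subfield m x]| = (2 ^ m)%N.
Proof. by apply: (card_in_subfield (r := 2)) => //; rewrite cardF mulnC. Qed.

(** The relative trace $v=t+t^{2^m}$ is a nonzero element of $L$. For $z=w/v$ with $w$ in $L$ of
    trace 1, the trace of $zt$ is that of $zv=w$. Thus $L$ contains its own trace-orthogonal. *)
Lemma half_subfield_orthogonal (t : F) : ~~ in_subfield m t ->
  exists2 z, in_subfield m z & to_bool (trace1 (2 * m) (z * t)).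
Proof.
move=> tm; set v := t + t ^+ (2 ^ m).
have v_neq0 : v != 0 by rewrite addr2_eq0 // eq_sym.
have vm : in_subfield m v.
  rewrite /in_subfield expr2D // -exprM -expnD addnn -mul2n.
  by rewrite (eqP (in_subfieldT t)) addrC.
have [w wm w1] : exists2 w : F, in_subfield m w & trace1 m w = 1.
  by apply: (trace1_neq0 char2 (r := 2)) => //; rewrite cardF mulnC.
have zm : in_subfield m (w / v) by rewrite in_subfieldM ?in_subfieldV.
exists (w / v) => //; rewrite trace1_double // exprMn (eqP zm) -mulrDr -/v.
by rewrite divfK // w1 /to_bool.
Qed.

(** On each coset of $L$ the Walsh summand is a constant sign times the character
    $z\mapsto\mathrm{Tr}(z(Tx+a))$, whose sum over $L$ vanishes unless $Tx+a\in L$; the second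
    hypothesis says that this happens on exactly one coset. *)
Lemma bent_of_half_subfield_translation (g : F -> bool) (T : F -> F) :
  (forall x z, in_subfield m z -> g (x + z) = g x (+) to_bool (trace1 (2 * m) (z * T x))) ->
  (forall a, exists x0, forall x, in_subfield m (T x + a) = in_subfield m (x + x0)) ->
  bent (2 * m) g.
Proof.
move=> g_transl T_coset a; rewrite /walsh -/(psi _).
pose s (b : bool) : int := (-1) ^+ b.
pose h x := g x (+) psi (a * x).
have s_addb b c : s (b (+) c) = s b * s c by rewrite /s signr_addb.
have h_transl x z : in_subfield m z -> h (x + z) = h x (+) psi (z * (T x + a)).
  move=> zm; rewrite /h g_transl // !mulrDr !psiD (mulrC a z) -/(psi _).
  by case: (g x) (psi _) (psi _) (psi _) => [] [] [] [].
have inner t : \sum_(z | in_subfield m z) s (psi (z * t)) = (2 ^ m)%N%:R * (in_subfield m t)%:R.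
  case: (boolP (in_subfield m t)) => tm.
    rewrite (eq_bigr (fun=> 1)) => [|z zm]; last by rewrite psi_half ?in_subfieldM.
    by rewrite mulr1 -card_half sumr_const; congr (_ *+ _); apply: eq_card => x; rewrite inE.
  have [z0 z0m z0t] := half_subfield_orthogonal tm.
  rewrite mulr0; set S := \sum_(z | _) _.
  (* Translating the summation variable by [z0] flips the sign of every term. *)
  suff: S = - S by lia.
  rewrite {1}/S (reindex_inj (addIr z0)) /= -sumrN.
  apply: eq_big => [z|z _]; first by rewrite in_subfield_addrK.
  by rewrite mulrDl psiD s_addb [psi (z0 * t)]z0t /s mulrN1.
have [x0 x0P] := T_coset a.
(* Both sides carry a factor $|L|$: on the left from averaging over translations, on the right from
   the character sum [inner]. The remaining $|L|$ on the right counts the surviving coset. *)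
have key : (2 ^ m)%N%:R * \sum_x s (h x) = (2 ^ m)%N%:R * ((2 ^ m)%N%:R * s (h x0)) :> int.
  transitivity (\sum_(z | in_subfield m z) \sum_x s (h (x + z))).
    rewrite -card_half mulr_natl -sumr_const; apply: eq_big => [z|z _]; first by rewrite inE.
    by rewrite [LHS](reindex_inj (addIr z)).
  rewrite exchange_big /= (eq_bigr (fun x =>
    s (h x) * ((2 ^ m)%N%:R * (in_subfield m (T x + a))%:R))); last first.
    by move=> x _; rewrite -inner big_distrr; apply: eq_bigr => z zm; rewrite h_transl.
  rewrite (eq_bigr (fun x => (2 ^ m)%N%:R * (s (h x) * (in_subfield m (x + x0))%:R))); last first.
    by move=> x _; rewrite mulrCA x0P.
  rewrite -big_distrr /=; congr (_ * _).
  rewrite (reindex_inj (addIr x0)) /= -card_half mulr_natl -sumr_const.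
  rewrite [RHS](eq_bigl (fun x => in_subfield m x)) => [|x]; last by rewrite inE.
  rewrite [RHS]big_mkcond; apply: eq_bigr => z _; rewrite (addrK_pchar2 char2).
  case: ifP => zm; last by rewrite mulr0.
  (* Since $x_0+x_0=0\in L$, also $Tx_0+a\in L$; the character is then trivial and [h] is constant
     on $x_0+L$. *)
  rewrite mulr1 addrC h_transl // psi_half ?addbF // in_subfieldM // x0P.
  by rewrite (addrr_pchar2 char2) in_subfield0.
have /mulfI/(_ _ _ key) -> : (2 ^ m)%N%:R != 0 :> int by rewrite pnatr_eq0 expn_eq0.
by rewrite normrM /s normr_sign mulr1 normr_nat mulKn // natz.
Qed.

End Bent.

(** * The quadratic part $\mathrm{Tr}^n_k(\omega x^{q+1})$, with $q=2^k$, $L=\mathbb{F}_{q^2}$, and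
    bentness of its perturbations *)

Section Quadratic.
Set Implicit Arguments. Unset Strict Implicit. Unset Printing Implicit Defensive.
Variables (F : finFieldType) (k : nat).
Hypotheses (char2 : 2%N \in [pchar F]) (k_gt0 : (0 < k)%N).
Hypothesis cardF : #|F| = (2 ^ (4 * k))%N.

Lemma expr_in_subfield m r (x : F) : in_subfield m x -> x ^+ (2 ^ (r * m)) = x.
Proof.
move=> /eqP xm; elim: r => [|r IH]; first by rewrite expn0 expr1.
by rewrite mulSn expnD exprM xm.
Qed.

Lemma in_subfield_dvd m r (x : F) : in_subfield m x -> in_subfield (r * m) x.
Proof. by move=> xm; rewrite /in_subfield expr_in_subfield. Qed.

Lemma in_subfield_4k (x : F) : in_subfield (4 * k) x.
Proof. by rewrite /in_subfield -cardF expf_card. Qed.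

Lemma expr_4k (x : F) : x ^+ (2 ^ (4 * k)) = x.
Proof. exact/eqP/in_subfield_4k. Qed.

(** Frobenius powers commute with the trace sum and fix its value, which is 0 or 1. *)
Lemma trace1_expr2 j (x : F) : trace1 (4 * k) (x ^+ (2 ^ j)) = trace1 (4 * k) x.
Proof.
transitivity (trace1 (4 * k) x ^+ (2 ^ j)).
  by rewrite /trace1 expr2_sum //; apply: eq_bigr => i _; rewrite exprAC.
rewrite trace1_01 ?in_subfield_4k //.
by case: (to_bool _); rewrite ?expr1n // expr0n expn_eq0.
Qed.

Lemma trace_4k_kD (x y : F) : trace_4k_k k (x + y) = trace_4k_k k x + trace_4k_k k y.
Proof. by rewrite /trace_4k_k !expr2D //; ring. Qed.

Lemma trace_4k_kZ (a x : F) :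
  in_subfield k a -> trace_4k_k k (a * x) = a * trace_4k_k k x.
Proof.
move=> ak; rewrite /trace_4k_k !exprMn (eqP ak) !(expr_in_subfield _ ak).
by ring.
Qed.

Lemma trace_4k_kX (x : F) : trace_4k_k k (x ^+ (2 ^ k)) = trace_4k_k k x.
Proof.
by rewrite /trace_4k_k -!exprM -!expnD addnn -mul2n -!mulSn expr_4k; ring.
Qed.

Lemma trace_4k_k_in (x : F) : in_subfield k (trace_4k_k k x).
Proof.
apply/eqP; rewrite -[RHS]trace_4k_kX /trace_4k_k !expr2D //.
by congr (_ + _ + _ + _); rewrite exprAC.
Qed.

(** The absolute trace is nonzero somewhere and factors through [trace_4k_k]. *)
Lemma trace_4k_k_nontrivial : exists x : F, trace_4k_k k x != 0.
Proof.
have [|||w _ w1] := @trace1_neq0 F char2 (4 * k) 1; rewrite ?muln1 ?muln_gt0 //.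
exists w; apply/eqP => w0; move: w1; rewrite trace1_4k // w0 trace1_0 //.
by move/eqP; rewrite eq_sym oner_eq0.
Qed.

Variable omega : F.
Hypothesis omegaU : in_subfield (2 * k) omega.
Hypothesis omega_neq_conj : omega + omega ^+ (2 ^ k) != 0.

(* The polar form of [Tr^n_1(omega x^{2^k+1})] is [Tr^n_1(z * T x)]. *)
Let T (x : F) : F := omega * x ^+ (2 ^ k) + omega ^+ (2 ^ k) * x ^+ (2 ^ (3 * k)).

(** The term in $z^{q+1}$ has trace 0 because it lies in $L$; of the two cross terms, the one in
    $z^q$ is brought to a multiple of $z$ by a Frobenius power. *)
Lemma trace1_gold (lam x z : F) : in_subfield k lam -> in_subfield (2 * k) z ->
  trace1 (4 * k) (lam * (omega * (x + z) ^+ (2 ^ k + 1))) =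
    trace1 (4 * k) (lam * (omega * x ^+ (2 ^ k + 1))) + trace1 (4 * k) (z * (lam * T x)).
Proof.
move=> lamk zL.
rewrite (_ : lam * (omega * (x + z) ^+ (2 ^ k + 1)) =
    lam * (omega * x ^+ (2 ^ k + 1)) + lam * (omega * z ^+ (2 ^ k + 1)) +
    (z * (lam * (omega * x ^+ (2 ^ k))) + lam * omega * z ^+ (2 ^ k) * x)); last first.
  by rewrite !addn1 !exprSr expr2D //; ring.
have lamL : in_subfield (2 * k) lam by apply: in_subfield_dvd.
have isotropic : trace1 (4 * k) (lam * (omega * z ^+ (2 ^ k + 1))) = 0.
  rewrite (_ : 4 * k = 2 * (2 * k))%N; last by lia.
  by rewrite trace1_half // !in_subfieldM // in_subfieldX.
rewrite !trace1D // isotropic addr0.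
(* The exponent $q^3$ is chosen because it turns $z^q$ into $z^{q^4}=z$; it also sends $\omega$ to
   $\omega^q$, as $\omega\in L$. *)
rewrite -(trace1_expr2 (3 * k) (_ * _ * _ * _)) -trace1D // /T.
have -> : (lam * omega * z ^+ (2 ^ k) * x) ^+ (2 ^ (3 * k)) =
    lam * omega ^+ (2 ^ k) * z * x ^+ (2 ^ (3 * k)).
  rewrite !exprMn (expr_in_subfield _ lamk) -(exprM z) -expnD -mulSn expr_4k.
  by rewrite {1}(mulSn 2) addnC expnD exprM (eqP omegaU).
by congr (_ + trace1 _ _); ring.
Qed.

Let TD x y : T (x + y) = T x + T y.
Proof. by rewrite /T !expr2D //; ring. Qed.

(** With $x^{q^4}=x$ and $\omega^{q^2}=\omega$ one gets
    $T(x)^{q^2}+T(x)=(\omega+\omega^q)(x^{q^2}+x)^q$, whose first factor is nonzero. *)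
Let T_half x : in_subfield (2 * k) (T x) = in_subfield (2 * k) x.
Proof.
rewrite /in_subfield -(addr2_eq0 char2) -(addr2_eq0 char2 (x ^+ _)).
rewrite (_ : T x ^+ _ + T x =
  (omega + omega ^+ (2 ^ k)) * (x ^+ (2 ^ (2 * k)) + x) ^+ (2 ^ k)).
  by rewrite mulf_eq0 (negPf omega_neq_conj) expf_eq0 expn_gt0.
rewrite /T !expr2D // !exprMn (exprAC omega) (eqP omegaU).
rewrite -!exprM -!expnD (_ : 3 * k + 2 * k = 4 * k + k)%N; last by lia.
rewrite (expnD _ (4 * k)) (exprM x (2 ^ (4 * k))) expr_4k.
rewrite (_ : 2 * k + k = 3 * k)%N; last by lia.
rewrite (_ : k + 2 * k = 3 * k)%N; last by lia.
ring.
Qed.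

(** A kernel element lies in $L$ by [T_half], and on $L$ the map is
    $z\mapsto(\omega+\omega^q)z^q$. *)
Let T_inj : injective T.
Proof.
move=> x y /eqP; rewrite -addr2_eq0 // -TD; move: (x + y) (addr2_eq0 char2 x y) => z xyz /eqP Tz0.
have zL : in_subfield (2 * k) z by rewrite -T_half Tz0 in_subfield0.
have : T z = (omega + omega ^+ (2 ^ k)) * z ^+ (2 ^ k).
  by rewrite /T (mulSn 2) addnC expnD exprM (eqP zL) mulrDl.
rewrite Tz0 => /esym/eqP; rewrite mulf_eq0 (negPf omega_neq_conj) expf_eq0 expn_gt0 /=.
by rewrite xyz => /eqP.
Qed.

Lemma gold_perturbation_bent (lam : F) (b : F -> bool) :
  in_subfield k lam -> lam != 0 ->
  (forall x z, in_subfield (2 * k) z -> b (x + z) = b x) ->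
  bent (4 * k) (fun x => to_bool (trace1 k
    (lam * (trace_4k_k k (omega * x ^+ (2 ^ k + 1)) + (b x)%:R)))).
Proof.
move=> lamk lam0 b_inv.
have e4 : (4 * k = 2 * (2 * k))%N by lia.
have lamL : in_subfield (2 * k) lam by apply: in_subfield_dvd.
have split_g x : to_bool (trace1 k (lam * (trace_4k_k k (omega * x ^+ (2 ^ k + 1)) + (b x)%:R))) =
   to_bool (trace1 (4 * k) (lam * (omega * x ^+ (2 ^ k + 1)))) (+)
     to_bool (trace1 k (lam * (b x)%:R)).
  rewrite mulrDr to_bool_trace1D // ?in_subfieldM ?trace_4k_k_in //.
    by rewrite -trace_4k_kZ // -trace1_4k.
  by case: (b x); rewrite ?in_subfield0 ?in_subfield1.
rewrite {1}e4; apply: (@bent_of_half_subfield_translation _ _ char2 _ _ _ (fun x => lam * T x)).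
- by rewrite muln_gt0.
- by rewrite -e4.
- move=> x z zL; rewrite !split_g b_inv // trace1_gold // trace1_01 ?in_subfield_4k //.
  rewrite [X in _ + X]trace1_01 ?in_subfield_4k // -natr_addb // !to_bool_natr -e4.
  by rewrite addbAC.
- move=> a; have [g _ Tg] := injF_bij T_inj.
  (* The coset representative is $T^{-1}(a/\lambda)$, so that $\lambda T(x)+a=\lambda T(x+x_0)$. *)
  exists (g (a / lam)) => x.
  have -> : lam * T x + a = lam * T (x + g (a / lam)).
    by rewrite TD Tg (mulrDr lam (T x) (a / lam)) (mulrC lam (a / lam)) divfK.
  rewrite -(T_half (x + _)); apply/idP/idP => [h|h]; last exact: in_subfieldM.
  by rewrite -(mulKf lam0 (T _)) in_subfieldM // in_subfieldV.
Qed.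

End Quadratic.

(** * A generator of $U$ lies outside $\mathbb{F}_q$ *)

Section UnitCircle.
Set Implicit Arguments. Unset Strict Implicit. Unset Printing Implicit Defensive.
Variables (F : finFieldType) (k : nat) (omega : F).
Hypotheses (char2 : 2%N \in [pchar F]) (k_gt0 : (0 < k)%N).
Hypothesis cardF : #|F| = (2 ^ (4 * k))%N.

(** If $\omega^q=\omega$, then $\omega^2=\omega^{q+1}=1$, so $\omega=1$ and $U$ is trivial. But
    $x^{q-1}\in U$ for every nonzero $x\in L$, so $x^q=x$ on all of $L$, contradicting
    $|L|=q^2>q$. *)
Lemma generator_neq_conj : omega ^+ (2 ^ k + 1) = 1 ->
  (forall x : F, in_subfield (2 * k) x -> x ^+ (2 ^ k + 1) = 1 ->
     exists m : nat, x = omega ^+ m) ->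
  omega + omega ^+ (2 ^ k) != 0.
Proof.
move=> omega_norm omega_gen; apply/negP; rewrite addr2_eq0 // => /eqP conj_omega.
have omega1 : omega = 1.
  apply/eqP; rewrite -addr2_eq0 // -sqrf_eq0 -[2%N]/(2 ^ 1)%N expr2D // expr1n.
  by rewrite expn1 expr2 {2}conj_omega -exprS -addn1 omega_norm (addrr_pchar2 char2).
have sub : [set x : F | in_subfield (2 * k) x] \subset [set x : F | in_subfield k x].
  apply/subsetP => x; rewrite !inE => xL.
  have [->|x0] := eqVneq x 0; first exact: in_subfield0.
  have [||m] := omega_gen (x ^+ (2 ^ k) / x).
  - by rewrite in_subfieldM ?in_subfieldX ?in_subfieldV.
  - rewrite exprMn exprVn addn1 !exprSr -exprM -expnD addnn -mul2n (eqP xL).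
    by rewrite (mulrC x) mulfV // mulf_neq0 // expf_neq0.
  by rewrite omega1 expr1n => /(canRL (divfK x0)); rewrite mul1r => /eqP.
have := subset_leq_card sub.
rewrite (@card_in_subfield _ (2 * k) 2) ?(@card_in_subfield _ k 4) ?muln_gt0 //.
- by rewrite leq_exp2l //; lia.
- by rewrite cardF mulnC.
- by rewrite cardF; congr (2 ^ _)%N; lia.
Qed.

End UnitCircle.

(** * Arithmetic and degree of reduced polynomials over $\mathbb{F}_2$ *)

Section AlgebraicNormalForm.
Set Implicit Arguments. Unset Strict Implicit. Unset Printing Implicit Defensive.
Variable m : nat.
Implicit Types (A B : {set {set 'I_m}}) (b : 'I_m -> bool).

(** This is addition of reduced polynomials: monomials occurring in both cancel. *)
Definition symdiff A B : {set {set 'I_m}} := [set S | (S \in A) (+) (S \in B)].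

Lemma anf_eval_symdiff A B b : anf_eval (symdiff A B) b = anf_eval A b (+) anf_eval B b.
Proof.
rewrite /anf_eval !(big_mkcond (fun S => S \in _)) -big_split /=.
by apply: eq_bigr => S _; rewrite inE; case: (S \in A) (S \in B) [forall i in S, b i] => [] [] [].
Qed.

Lemma anf_eval0 b : anf_eval set0 b = false.
Proof. by rewrite /anf_eval big_set0. Qed.

Lemma anf_deg_leP A d : reflect (forall S, S \in A -> (#|S| <= d)%N) (anf_deg A <= d)%N.
Proof. exact: bigmax_leqP. Qed.

Lemma leq_anf_deg A S : S \in A -> (#|S| <= anf_deg A)%N.
Proof. by move=> SA; apply: (anf_deg_leP A (anf_deg A)). Qed.

Lemma anf_deg0 : anf_deg (set0 : {set {set 'I_m}}) = 0%N.
Proof. by rewrite /anf_deg big_set0. Qed.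

Lemma anf_deg_symdiff_le A B d :
  (anf_deg A <= d)%N -> (anf_deg B <= d)%N -> (anf_deg (symdiff A B) <= d)%N.
Proof.
move=> /anf_deg_leP Ad /anf_deg_leP Bd; apply/anf_deg_leP => S; rewrite inE.
by case: (boolP (S \in A)) => [/Ad|_ /Bd].
Qed.

(** A monomial of top degree in [B] is too large to occur in [A], hence is not cancelled. *)
Lemma anf_deg_symdiff_ge A B :
  (anf_deg A < anf_deg B)%N -> (anf_deg B <= anf_deg (symdiff A B))%N.
Proof.
move=> ltAB; have B_gt0 : (0 < #|B|)%N.
  by rewrite card_gt0; apply: contraTneq ltAB => ->; rewrite anf_deg0.
have [S SB degB] := eq_bigmax_cond (fun S : {set 'I_m} => #|S|) B_gt0.
rewrite -/(anf_deg B) in degB; rewrite degB; apply: leq_anf_deg.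
rewrite inE SB addbT; apply/negP => /leq_anf_deg.
by rewrite -degB leqNgt ltAB.
Qed.

(** It suffices to check single variables and the monomial 1; the value at zero corrects the latter,
    since $1=1+1+1$. *)
Lemma anf_eval_affine A b b' : (anf_deg A <= 1)%N ->
  anf_eval A (fun i => b i (+) b' i) =
    anf_eval A b (+) anf_eval A b' (+) anf_eval A (fun=> false).
Proof.
move=> /anf_deg_leP A1; rewrite /anf_eval -!big_split; apply: eq_bigr => S /A1.
rewrite leq_eqVlt ltnS leqn0 cards_eq0 => /orP[/cards1P[i ->]|/eqP->] /=.
  have mono1 (f : 'I_m -> bool) : [forall j in [set i], f j] = f i.
    by apply/forall_inP/idP => [->|fi j /set1P->] //; rewrite inE.
  by rewrite !mono1 addbF.
have mono0 (f : 'I_m -> bool) : [forall j in (set0 : {set 'I_m}), f j] = true.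
  by apply/forall_inP => j; rewrite inE.
by rewrite !mono0.
Qed.

(** The sum of $s_{ij}X_iX_j$ over all ordered pairs, reduced: the diagonal set [[set i; i]] is a
    singleton, matching $X_i^2=X_i$, and equal contributions of $(i,j)$ and $(j,i)$ cancel. *)
Definition anf_quadratic (s : 'I_m -> 'I_m -> bool) : {set {set 'I_m}} :=
  \big[symdiff/set0]_i \big[symdiff/set0]_j (if s i j then [set [set i; j]] else set0).

Lemma anf_eval_quadratic s b :
  anf_eval (anf_quadratic s) b =
    \big[addb/false]_i \big[addb/false]_j ((b i && b j) && s i j).
Proof.
pose morph := big_morph (fun A => anf_eval A b)
  (fun A B => anf_eval_symdiff A B b) (anf_eval0 b).
rewrite morph; apply: eq_bigr => i _; rewrite morph; apply: eq_bigr => j _.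
case: ifP => _; rewrite ?andbF ?anf_eval0 // andbT /anf_eval big_set1.
apply/forall_inP/andP => [bS|[bi bj] l]; first by rewrite !bS // !inE eqxx ?orbT.
by rewrite !inE => /orP[]/eqP->.
Qed.

Lemma anf_deg_quadratic s : (anf_deg (anf_quadratic s) <= 2)%N.
Proof.
apply: (big_ind (fun A => anf_deg A <= 2)%N) => [|A B|i _].
- by rewrite anf_deg0.
- exact: anf_deg_symdiff_le.
apply: (big_ind (fun A => anf_deg A <= 2)%N) => [|A B|j _].
- by rewrite anf_deg0.
- exact: anf_deg_symdiff_le.
case: ifP => _; last by rewrite anf_deg0.
by apply/anf_deg_leP => S /set1P->; rewrite cards2; case: (i == j).
Qed.

End AlgebraicNormalForm.

(** * Injective renaming of variables *)

Section AnfRename.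
Set Implicit Arguments. Unset Strict Implicit. Unset Printing Implicit Defensive.
Variables (m n : nat) (f : 'I_m -> 'I_n) (A : {set {set 'I_m}}).
Hypothesis f_inj : injective f.

Definition anf_rename : {set {set 'I_n}} := [set f @: (S : {set 'I_m}) | S in A].

Lemma anf_eval_rename (b : 'I_n -> bool) : anf_eval anf_rename b = anf_eval A (b \o f).
Proof.
rewrite /anf_eval /anf_rename big_imset /=; last by move=> S S' _ _; apply: imset_inj.
apply: eq_bigr => S _; apply/forall_inP/forall_inP => [bS i iS|bS _ /imsetP[i iS ->]].
  exact/bS/imset_f.
exact: bS.
Qed.

Lemma anf_deg_rename : anf_deg anf_rename = anf_deg A.
Proof.
rewrite /anf_deg /anf_rename big_imset /=; last by move=> S S' _ _; apply: imset_inj.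
by apply: eq_bigr => S _; rewrite card_imset.
Qed.

End AnfRename.

(** * Linear independence and bases over $\mathbb{F}_2$ *)

Section LinearAlgebra.
Set Implicit Arguments. Unset Strict Implicit. Unset Printing Implicit Defensive.
Variables (F : finFieldType).
Hypotheses (char2 : 2%N \in [pchar F]).

Lemma eq_lincomb m (e : 'I_m -> F) (b b' : 'I_m -> bool) :
  b =1 b' -> lincomb e b = lincomb e b'.
Proof. by move=> bb'; apply: eq_bigr => i _; rewrite bb'. Qed.

Lemma lincombD m (e : 'I_m -> F) (b b' : 'I_m -> bool) :
  lincomb e (fun i => b i (+) b' i) = lincomb e b + lincomb e b'.
Proof.
by rewrite /lincomb -big_split; apply: eq_bigr => i _; rewrite natr_addb // mulrDl.
Qed.

Lemma lincomb0 m (e : 'I_m -> F) : lincomb e (fun=> false) = 0.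
Proof. by rewrite /lincomb big1 // => i _; rewrite mul0r. Qed.

Lemma lincomb_eq m (e : 'I_m -> F) (b b' : 'I_m -> bool) : F2_lin_indep e ->
  lincomb e b = lincomb e b' -> b =1 b'.
Proof.
move=> indep_e bb' i; apply/eqP; rewrite -negb_add; apply/negPf.
by apply: (indep_e (fun i => b i (+) b' i)); rewrite lincombD bb' (addrr_pchar2 char2).
Qed.

Lemma in_subfield_lincomb s m (e : 'I_m -> F) (b : 'I_m -> bool) :
  (forall i, in_subfield s (e i)) -> in_subfield s (lincomb e b).
Proof.
move=> es; apply: (big_ind (in_subfield s)) => [|x y|i _].
- exact: in_subfield0.
- exact: in_subfieldD.
by case: (b i); rewrite ?mul1r ?mul0r ?in_subfield0.
Qed.

Lemma card_span m (e : 'I_m -> F) : F2_lin_indep e ->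
  #|[set lincomb e b | b : {ffun 'I_m -> bool}]| = (2 ^ m)%N.
Proof.
move=> indep_e; rewrite card_imset ?card_ffun ?card_bool ?card_ord // => b b' bb'.
exact/ffunP/(lincomb_eq indep_e).
Qed.

(** Counting: the span has $2^s$ elements and lies in a subfield of the same size. *)
Lemma basis_of_lin_indep s (e : 'I_s -> F) :
  #|[set x : F | in_subfield s x]| = (2 ^ s)%N ->
  (forall i, in_subfield s (e i)) -> F2_lin_indep e -> basis_of_subfield s e.
Proof.
move=> card_s es indep_e; split; [|split].
- by move=> b b' bb'; apply/ffunP/(lincomb_eq indep_e).
- by move=> b; apply: in_subfield_lincomb.
have /eqP span_s : [set lincomb e b | b : {ffun 'I_s -> bool}] == [set x : F | in_subfield s x].
  rewrite eqEcard card_s card_span // leqnn andbT; apply/subsetP => _ /imsetP[b _ ->].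
  by rewrite inE in_subfield_lincomb.
move=> x xs; have : x \in [set lincomb e b | b : {ffun 'I_s -> bool}] by rewrite span_s inE.
by case/imsetP => b _ ->; exists b.
Qed.

(** A relation with coefficient 1 on [v] would put [v] in the span. Families are indexed by [nat] so
    that lengthening them needs no change of index type. *)
Lemma lin_indep_extend1 m (e : nat -> F) (v : F) :
  F2_lin_indep (fun i : 'I_m => e i) ->
  v \notin [set lincomb (fun i : 'I_m => e i) b | b : {ffun 'I_m -> bool}] ->
  F2_lin_indep (fun i : 'I_m.+1 => if (i < m)%N then e i else v).
Proof.
move=> indep_e v_notin b.
have -> : lincomb (fun i : 'I_m.+1 => if (i < m)%N then e i else v) b =
    lincomb (fun i : 'I_m => e i) (fun i => b (widen_ord (leqnSn m) i)) + (b ord_max)%:R * v.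
  rewrite {1}/lincomb big_ord_recr /= ltnn; congr (_ + _).
  by apply: eq_bigr => i _ /=; rewrite ltn_ord.
have bmax : lincomb (fun i : 'I_m => e i) (fun i => b (widen_ord (leqnSn m) i)) +
    (b ord_max)%:R * v = 0 -> b ord_max = false.
  case: (b ord_max) => //; rewrite mul1r => /eqP; rewrite addr2_eq0 // => /eqP v_span.
  case/negP: v_notin; rewrite -v_span; apply/imsetP.
  exists [ffun i => b (widen_ord (leqnSn m) i)] => //.
  by apply: eq_lincomb => i; rewrite ffunE.
move=> b0; move: (b0); rewrite (bmax b0) mul0r addr0 => /indep_e b_widen i.
have [im|mi] := ltnP i m; first by rewrite -(b_widen (Ordinal im)); congr b; apply: val_inj.
by rewrite -(bmax b0); congr b; apply/val_inj/eqP; rewrite eqn_leq mi -ltnS ltn_ord.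
Qed.

(** Vectors are added one at a time: fewer than [s] of them span fewer than $2^s$ elements, so the
    subfield has one outside the span. *)
Lemma lin_indep_extend s m (e : nat -> F) : (m <= s)%N ->
  #|[set x : F | in_subfield s x]| = (2 ^ s)%N ->
  (forall i, in_subfield s (e i)) -> F2_lin_indep (fun i : 'I_m => e i) ->
  exists e' : nat -> F, [/\ forall i, (i < m)%N -> e' i = e i,
    forall i, in_subfield s (e' i) & F2_lin_indep (fun i : 'I_s => e' i)].
Proof.
move=> ms card_s es indep_e.
suff ext r : (m + r <= s)%N -> exists e' : nat -> F,
    [/\ forall i, (i < m)%N -> e' i = e i, forall i, in_subfield s (e' i) &
        F2_lin_indep (fun i : 'I_(m + r) => e' i)].
  by have := ext (s - m)%N; rewrite subnKC // => /(_ (leqnn s)).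
elim: r => [|r IH] mrs; first by exists e; rewrite addn0.
have [|e1 [e1e e1s indep_e1]] := IH; first by rewrite (leq_trans _ mrs) // leq_add2l.
have /subsetPn[v] : ~~ ([set x : F | in_subfield s x] \subset
    [set lincomb (fun i : 'I_(m + r) => e1 i) b | b : {ffun 'I_(m + r) -> bool}]).
  apply/negP => /subset_leq_card; rewrite card_s card_span // leq_exp2l //.
  by rewrite leqNgt -addnS mrs.
rewrite inE => vs v_notin.
exists (fun i => if (i < m + r)%N then e1 i else v); split.
- by move=> i im; rewrite (leq_trans im) ?leq_addr // e1e.
- by move=> i; case: ifP.
by rewrite addnS; apply: lin_indep_extend1.
Qed.

Lemma subfield_basis_exists s : #|[set x : F | in_subfield s x]| = (2 ^ s)%N ->
  exists c : 'I_s -> F, basis_of_subfield s c.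
Proof.
move=> card_s.
have [||c [_ cs indep_c]] := @lin_indep_extend s 0 (fun=> 0) (leq0n s) card_s.
- by move=> i; apply: in_subfield0.
- by move=> b _ [].
by exists (fun i : 'I_s => c i); apply: basis_of_lin_indep.
Qed.

End LinearAlgebra.

(** * Trace-dual coordinates and the algebraic degree *)

Section Degree.
Set Implicit Arguments. Unset Strict Implicit. Unset Printing Implicit Defensive.
Variables (F : finFieldType).
Hypothesis char2 : 2%N \in [pchar F].

(** The map $x\mapsto(\mathrm{Tr}(v_ix))_i$ is injective because the trace form is nondegenerate,
    hence bijective by counting; the dual basis consists of the preimages of the unit vectors. *)
Lemma trace_dual_basis n (v : 'I_n -> F) : (0 < n)%N -> #|F| = (2 ^ n)%N ->
  F2_lin_indep v ->
  exists2 e : 'I_n -> F, basis_of_subfield n e &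
    forall (b : 'I_n -> bool) i, to_bool (trace1 n (v i * lincomb e b)) = b i.
Proof.
move=> n_gt0 cardF indep_v.
have inT (x : F) : in_subfield n x by rewrite /in_subfield -cardF expf_card.
have card_n : #|[set x : F | in_subfield n x]| = (2 ^ n)%N.
  by rewrite -cardF; apply: eq_card => x; rewrite inE inT.
pose psi (x : F) := to_bool (trace1 n x).
have psiD x y : psi (x + y) = psi x (+) psi y by rewrite /psi to_bool_trace1D.
have psi0 : psi 0 = false by rewrite /psi trace1_0 // /to_bool eq_sym oner_eq0.
have psi_nat (b : bool) x : psi (b%:R * x) = b && psi x.
  by case: b; rewrite ?mul1r ?mul0r.
have psi_lincomb (e : 'I_n -> F) b y :
    psi (lincomb e b * y) = \big[addb/false]_i (b i && psi (e i * y)).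
  rewrite mulr_suml (big_morph psi psiD psi0).
  by apply: eq_bigr => i _; rewrite -mulrA psi_nat.
have [_ [_ v_span]] := basis_of_lin_indep char2 card_n (fun i => inT (v i)) indep_v.
pose coords (x : F) := [ffun i => psi (v i * x)].
have coords_inj : injective coords.
  move=> x y /ffunP xy; apply/eqP; rewrite -addr2_eq0 //; apply: contraT => z_neq0.
  have [|||w _ w1] := @trace1_neq0 F char2 n 1; rewrite ?muln1 //.
  (* With $w$ of trace 1 and $w/(x+y)$ expanded along [v], the trace of $w$ becomes a sum of the
     values $\mathrm{Tr}(v_i(x+y))$, all zero if the coordinates of $x$ and $y$ agree. *)
  have [b bw] := v_span (w / (x + y)) (inT _).
  have : psi w by rewrite /psi w1 /to_bool.
  rewrite -(divfK z_neq0 w) -bw psi_lincomb big1 // => i _.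
  by have := xy i; rewrite !ffunE mulrDr psiD => ->; rewrite addbb andbF.
have [|g _ gK] := inj_card_bij coords_inj.
  by rewrite card_ffun card_bool card_ord cardF.
pose e i := g [ffun j => j == i].
have psi_ve i j : psi (v i * e j) = (i == j).
  by have /ffunP/(_ i) := gK [ffun i => i == j]; rewrite !ffunE.
have dual (b : 'I_n -> bool) i : psi (v i * lincomb e b) = b i.
  rewrite mulrC psi_lincomb (bigD1 i) //= big1 => [|j /negPf ji].
    by rewrite mulrC psi_ve eqxx andbT addbF.
  by rewrite mulrC psi_ve eq_sym ji andbF.
exists e => //; apply: basis_of_lin_indep => // b b0 i.
by rewrite -dual b0 mulr0.
Qed.

Lemma lincomb_sum m (c : 'I_m -> F) (I : finType) (f : I -> 'I_m -> bool) :
  lincomb c (fun j => \big[addb/false]_i f i j) = \sum_i lincomb c (f i).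
Proof.
rewrite /lincomb exchange_big; apply: eq_bigr => j _ /=.
rewrite -mulr_suml; congr (_ * _).
by apply: (big_morph (fun a : bool => a%:R : F) (natr_addb char2)).
Qed.

Lemma lincomb_andb m (c : 'I_m -> F) (a : bool) (b : 'I_m -> bool) :
  lincomb c (fun j => a && b j) = a%:R * lincomb c b.
Proof. by case: a; rewrite ?mul1r // mul0r; apply: lincomb0. Qed.

Variable k : nat.
Hypotheses (k_gt0 : (0 < k)%N) (cardF : #|F| = (2 ^ (4 * k))%N).
Variable omega : F.
Hypothesis omegaU : in_subfield (2 * k) omega.
Hypothesis omega_neq_conj : omega + omega ^+ (2 ^ k) != 0.

Let gold (x : F) := trace_4k_k k (omega * x ^+ (2 ^ k + 1)).

Let trace_4k_k0 : trace_4k_k k (0 : F) = 0.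
Proof. by rewrite /trace_4k_k !expr0n !expn_eq0 !addr0. Qed.

Let trace_4k_k_sum := big_morph (trace_4k_k k) (trace_4k_kD k char2) trace_4k_k0.

(** Writing $x^{q+1}=x^q\cdot x$ makes the expression bilinear in the bits, which Frobenius
    fixes. *)
Lemma gold_lincomb n (e : 'I_n -> F) (b : 'I_n -> bool) :
  gold (lincomb e b) = \sum_i \sum_j
    (b i && b j)%:R * trace_4k_k k (omega * (e i ^+ (2 ^ k) * e j)).
Proof.
rewrite /gold addn1 exprSr {1}/lincomb expr2_sum // mulr_suml mulr_sumr.
rewrite trace_4k_k_sum; apply: eq_bigr => i _.
rewrite mulr_sumr mulr_sumr trace_4k_k_sum; apply: eq_bigr => j _.
case: (b i); last by rewrite !mul0r expr0n expn_eq0 mul0r mulr0 trace_4k_k0.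
by case: (b j); rewrite ?mul1r // !mul0r !mulr0 trace_4k_k0.
Qed.

(** The second difference is $\mathrm{Tr}^n_k(\omega x+\omega
    x^q)=\mathrm{Tr}^n_k((\omega+\omega^q)x)$; the chosen $x$ makes the argument an element $t$ of
    nonzero trace. *)
Lemma gold_not_affine : exists x, gold (x + 1) + gold x + gold 1 + gold 0 != 0.
Proof.
have [t t_neq0] := trace_4k_k_nontrivial char2 k_gt0 cardF.
exists (t / (omega + omega ^+ (2 ^ k))); set x := t / _.
suff -> : gold (x + 1) + gold x + gold 1 + gold 0 = trace_4k_k k t by [].
have -> : gold 0 = 0 by rewrite /gold addn1 expr0n mulr0 trace_4k_k0.
have -> : gold (x + 1) = gold x + gold 1 + trace_4k_k k t.
  have tE : t = omega * x + omega ^+ (2 ^ k) * x by rewrite -mulrDl mulrC divfK.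
  have -> : trace_4k_k k t = trace_4k_k k (omega * x + omega * x ^+ (2 ^ k)).
    rewrite tE !trace_4k_kD //; congr (_ + _).
    by rewrite -[LHS]trace_4k_kX // exprMn -exprM -expnD addnn -mul2n (eqP omegaU).
  rewrite /gold -!trace_4k_kD //; congr (trace_4k_k k _).
  by rewrite !addn1 !exprSr expr2D // !expr1n; ring.
move: (gold x) (gold 1) (trace_4k_k k t) => a b c; rewrite addr0.
rewrite (_ : a + b + c + a + b = c + (a + a) + (b + b)); last by ring.
by rewrite !(addrr_pchar2 char2) !addr0.
Qed.

Lemma gold_perturbation_degree tau (P : {set {set 'I_tau}}) (v : 'I_tau -> F) :
  (tau <= 4 * k)%N -> (forall j, in_subfield (2 * k) (v j)) ->
  F2_lin_indep v -> (2 <= anf_deg P)%N ->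
  vec_alg_degree (4 * k) k
    (fun x => gold x + (anf_eval P (fun j => to_bool (trace1 (4 * k) (v j * x))))%:R)
    (anf_deg P).
Proof.
move=> tau_le vL indep_v degP; set H := fun x => _.
have n_gt0 : (0 < 4 * k)%N by rewrite muln_gt0.
have inT (x : F) : in_subfield (4 * k) x by apply: in_subfield_4k.
have card_n : #|[set x : F | in_subfield (4 * k) x]| = (2 ^ (4 * k))%N.
  by rewrite -cardF; apply: eq_card => x; rewrite inE inT.
(* Padding with 0 beyond [tau] only makes the family total; the extension keeps just the values
   below [tau]. *)
pose v0 (i : nat) : F := oapp v 0 (insub i).
have v0E (j : 'I_tau) : v0 j = v j by rewrite /v0 valK.
have [||v1 [v1E _ indep_v1]] := lin_indep_extend char2 tau_le card_n (e := v0) => //.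
  move=> b b0; apply: indep_v; rewrite -[RHS]b0.
  by apply: eq_bigr => j _; rewrite v0E.
have [e basis_e dual_e] := trace_dual_basis n_gt0 cardF indep_v1.
pose f := widen_ord tau_le; have f_inj : injective f by move=> i j /(congr1 val) /= /val_inj.
have v1f j : v1 (f j) = v j by rewrite -v0E -v1E.
have card_k : #|[set x : F | in_subfield k x]| = (2 ^ k)%N.
  by apply: (card_in_subfield (r := 4)) => //; rewrite cardF mulnC.
have [c basis_c] := subfield_basis_exists char2 card_k.
(* Coordinates in the basis [c], with the zero vector as default outside the subfield. *)
pose coord (x : F) : {ffun 'I_k -> bool} :=
  odflt [ffun=> false] [pick b : {ffun 'I_k -> bool} | lincomb c b == x].
have coordK x : in_subfield k x -> lincomb c (coord x) = x.
  move=> xk; rewrite /coord; case: pickP => [b /eqP //|none].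
  by have [_ [_ /(_ x xk)[b bx]]] := basis_c; have := none b; rewrite bx eqxx.
pose s (j : 'I_k) i i' := coord (trace_4k_k k (omega * (e i ^+ (2 ^ k) * e i'))) j.
(* The boolean summand is a multiple of $1\in\mathbb{F}_{2^k}$, so it enters exactly those
   coordinates in which 1 has coefficient 1. *)
pose R (j : 'I_k) := if coord 1 j then anf_rename f P else set0.
pose Q j := symdiff (anf_quadratic (s j)) (R j).
have HE (b : 'I_(4 * k) -> bool) : H (lincomb e b) = lincomb c (fun j => anf_eval (Q j) b).
  rewrite (eq_lincomb c (fun j => anf_eval_symdiff (anf_quadratic (s j)) (R j) b)).
  rewrite lincombD // /H; congr (_ + _).
    rewrite gold_lincomb (eq_lincomb c (fun j => anf_eval_quadratic (s j) b)).
    rewrite lincomb_sum; apply: eq_bigr => i _; rewrite lincomb_sum; apply: eq_bigr => i' _.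
    by rewrite lincomb_andb coordK // trace_4k_k_in.
  have -> : anf_eval P (fun j => to_bool (trace1 (4 * k) (v j * lincomb e b))) =
      anf_eval (anf_rename f P) b.
    rewrite anf_eval_rename //; apply: eq_bigr => S _; apply: eq_forallb_in => j _ /=.
    by rewrite -dual_e v1f.
  rewrite -[LHS]mulr1 -[X in _ * X]coordK ?in_subfield1 // -lincomb_andb.
  by apply: eq_lincomb => j; rewrite /R; case: ifP => _; rewrite ?andbT ?andbF ?anf_eval0.
(* The upper bound comes first: the quadratic part has degree at most 2, which does not exceed the
   degree of [P]. *)
exists e, c, Q; split => //; apply/eqP; rewrite eqn_leq; apply/andP; split; last first.
  apply/bigmax_leqP => j _; apply: anf_deg_symdiff_le.
    exact: leq_trans (anf_deg_quadratic _) degP.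
  by rewrite /R; case: ifP => _; rewrite ?anf_deg0 ?anf_deg_rename.
have [degP_gt2|degP_le2] := ltnP 2 (anf_deg P).
  (* Since $1\ne0$, some coordinate contains [P], and there its top monomials exceed the quadratic
     part. *)
  have [j j1|none] := pickP (coord 1).
    apply: leq_trans (leq_bigmax j); rewrite -(anf_deg_rename P f_inj) /Q /R j1.
    apply: anf_deg_symdiff_ge; rewrite anf_deg_rename //.
    exact: leq_ltn_trans (anf_deg_quadratic _) degP_gt2.
  have := coordK 1 (in_subfield1 _ _); rewrite (eq_lincomb c none) lincomb0.
  by move/esym/eqP; rewrite oner_eq0.
(* In degree 2 the top terms might cancel; if they did in every coordinate, [H] would be affine. *)
apply: leq_trans degP_le2 _; rewrite ltnNge; apply/negP => /bigmax_leqP Q_affine.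
have [x /negP[]] := gold_not_affine; apply/eqP.
have [_ [_ e_span]] := basis_e.
have H_affine y z : H (y + z) = H y + H z + H 0.
  have [[b <-] [b' <-]] := (e_span y (inT y), e_span z (inT z)).
  rewrite -(lincomb0 e) -lincombD // !HE -!lincombD //.
  by apply: eq_lincomb => j; rewrite anf_eval_affine ?Q_affine.
(* As $v_j\in L$ gives $\mathrm{Tr}(v_j)=0$, the boolean part is unchanged by $y\mapsto y+1$, so [H]
   and [gold] have the same derivative in direction 1. *)
have inv y : H (y + 1) + H y = gold (y + 1) + gold y.
  have -> : H (y + 1) = gold (y + 1) +
      (anf_eval P (fun j => to_bool (trace1 (4 * k) (v j * y))))%:R.
    congr (_ + (nat_of_bool _)%:R); apply: eq_bigr => S _; apply: eq_forallb_in => j _.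
    rewrite mulrDr mulr1 trace1D // (_ : trace1 _ (v j) = 0) ?addr0 //.
    by rewrite (_ : 4 * k = 2 * (2 * k))%N ?trace1_half //; lia.
  by rewrite /H addrACA (addrr_pchar2 char2) addr0.
have inv0 := inv 0; rewrite add0r in inv0; rewrite -addrA -inv -inv0 H_affine.
move: (H x) (H 1) (H 0) => p q r.
rewrite (_ : p + q + r + p + (q + r) = (p + p) + (q + q) + (r + r)); last by ring.
by rewrite !(addrr_pchar2 char2).
Qed.

End Degree.

(** * Bentness and degree of $H$ for the family $u_{i_1},\ldots,u_{i_\tau}$ *)

Theorem theorem7 (k : nat) (hk : (2 <= k)%N)
  (F : finFieldType) (hchar : 2%N \in [pchar F]) (hcard : #|F| = (2 ^ (4 * k))%N)
  (tau : nat) (htau : (1 <= tau <= k)%N)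
  (u : 'I_k -> F)
  (hu : forall i, in_subfield (2 * k) (u i) /\ u i != 0)
  (huij : forall i j : 'I_k, (i < j)%N ->
            in_subfield k (u i * u j ^+ (2 ^ k)) /\ u i * u j ^+ (2 ^ k) != 0)
  (P : {set {set 'I_tau}})
  (omega : F)
  (homega : [/\ in_subfield (2 * k) omega, omega ^+ (2 ^ k + 1) = 1 &
              forall x : F, in_subfield (2 * k) x -> x ^+ (2 ^ k + 1) = 1 ->
                exists m : nat, x = omega ^+ m])
  (idx : 'I_tau -> 'I_k) (hidx : injective idx) :
  let H := fun x : F =>
    trace_4k_k k (omega * x ^+ (2 ^ k + 1)) +
    (nat_of_bool (anf_eval P (fun j => to_bool (trace1 (4 * k) (u (idx j) * x)))))%:R in
  vbent (4 * k) k H /\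
  (F2_lin_indep u -> (2 <= anf_deg P)%N -> vec_alg_degree (4 * k) k H (anf_deg P)).
Proof.
have [omegaL omega_norm omega_gen] := homega.
have k_gt0 : (0 < k)%N by lia.
have omega_neq := generator_neq_conj hchar k_gt0 hcard omega_norm omega_gen.
move=> H; split=> [lam lamk lam0|indep_u degP].
  apply: gold_perturbation_bent => // x z zL.
  apply: eq_bigr => S _; apply: eq_forallb_in => j _.
  rewrite mulrDr trace1D // (_ : trace1 _ (u _ * z) = 0) ?addr0 //.
  rewrite (_ : 4 * k = 2 * (2 * k))%N; last by lia.
  by rewrite trace1_half // in_subfieldM // (hu _).1.
apply: (gold_perturbation_degree hchar k_gt0 hcard omegaL omega_neq) => //; first by lia.
  by move=> j; apply: (hu _).1.
(* A relation among the selected $u_{i_j}$ is extended by zero coefficients to a relation among all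
   $u_i$; injectivity of [idx] makes the extension agree with [b]. *)
move=> b b0 j; pose b' i := [exists j', (idx j' == i) && b j'].
have b'_idx j' : b' (idx j') = b j'.
  by apply/existsP/idP => [[i /andP[/eqP/hidx->]]|bj] //; exists j'; rewrite eqxx.
rewrite -b'_idx; apply: indep_u; rewrite -[RHS]b0 /lincomb.
rewrite (bigID (fun i => i \in [set idx j | j : 'I_tau])) /=.
rewrite [X in _ + X]big1 ?addr0 => [|i i_notin]; last first.
  rewrite /b'; case: existsP => [[j' /andP[/eqP ij' _]]|_]; last by rewrite mul0r.
  by rewrite -ij' imset_f in i_notin.
rewrite big_imset /=; last by move=> j' j'' _ _; apply: hidx.
by apply: eq_big => [j'|j' _]; rewrite ?inE ?b'_idx.
Qed.
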